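(* Let $P,Q\in\mathbb{C}$ with $Q\ne 0$, and let $(D_n)_{n\in\mathbb{Z}}$ be the Lucas sequence with parameters $P,Q$. For any $(a_1,a_2,a_3,b)\in\mathbb{Z}^4$, $$\frac{D_{b-a_3}D_{b+a_3}D_{a_1-a_2}D_{a_1+a_2}}{Q^{a_1}}+\frac{D_{b-a_1}D_{b+a_1}D_{a_2-a_3}D_{a_2+a_3}}{Q^{a_2}}+\frac{D_{b-a_2}D_{b+a_2}D_{a_3-a_1}D_{a_3+a_1}}{Q^{a_3}}=0.$$
   Context: The Lucas sequence $(D_n)_{n\in\mathbb{Z}}$ is defined by $D_0=0$, $D_1=1$, $D_{n+2}=PD_{n+1}-QD_n$ for all $n\in\mathbb{Z}$; equivalently it is extended to negative indices by $D_{-n}=-D_n/Q^n$. *)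

(* Defs.v *)
From HB Require Import structures.
From mathcomp Require Import all_boot all_order all_algebra.
From mathcomp Require Import complex.
From mathcomp Require Import reals.
From mathcomp Require Import zify ring.

Set Implicit Arguments.
Unset Strict Implicit.
Unset Printing Implicit Defensive.

Import Order.TTheory GRing.Theory Num.Theory.

Local Open Scope ring_scope.

(* The recurrence on all of [int] together with [D 0] and [D 1] determines [D]
   when [Q != 0]: see [lucasP] (existence) and [is_lucas_eq] (uniqueness). *)
Definition is_lucas (F : fieldType) (P Q : F) (D : int -> F) : Prop :=
  [/\ D 0 = 0, D 1 = 1 &
      forall n : int, D (n + 2) = P * D (n + 1) - Q * D n].

Fixpoint lucas_nat (F : fieldType) (P Q : F) (n : nat) : F :=
  match n with
  | 0 => 0
  | 1 => 1
  | (m.+1 as k).+1 => P * lucas_nat P Q k - Q * lucas_nat P Q m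
  end.

Definition lucas (F : fieldType) (P Q : F) (n : int) : F :=
  match n with
  | Posz m => lucas_nat P Q m
  | Negz m => - lucas_nat P Q m.+1 / Q ^+ m.+1
  end.

Lemma lucasN (F : fieldType) (P Q : F) (n : int) :
  Q != 0 -> lucas P Q (- n) = - lucas P Q n / Q ^ n.
Proof.
move=> Q0; case: n => [[|m]|m] //; first by rewrite /= !oppr0 mul0r.
have -> : lucas P Q (- Negz m) = lucas_nat P Q m.+1 by [].
have -> : lucas P Q (Negz m) = - lucas_nat P Q m.+1 / Q ^+ m.+1 by [].
have -> : Q ^ Negz m = (Q ^+ m.+1)^-1 by [].
by rewrite invrK mulNr mulfVK ?opprK // expf_neq0.
Qed.

Lemma lucasP (F : fieldType) (P Q : F) : Q != 0 -> is_lucas P Q (lucas P Q).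
Proof.
move=> Q0; split=> // -[m|[|[|m]]].
- by rewrite -!PoszD addn2 addn1.
- rewrite (_ : Negz 0 + 2 = 1) // (_ : Negz 0 + 1 = 0) //=.
  by rewrite mulr0 sub0r expr1 mulrCA divff // mulr1 opprK.
- rewrite (_ : Negz 1 + 2 = 0) // (_ : Negz 1 + 1 = Negz 0) //=.
  rewrite mulr0 subr0 mulr1 expr1 mulNr mulrN mulNr mulrN opprK mul1r.
  by rewrite expr2 invfM mulrCA !mulrA mulfK // addNr.
rewrite (_ : Negz m.+2 + 2 = Negz m); last by rewrite !NegzE; lia.
rewrite (_ : Negz m.+2 + 1 = Negz m.+1); last by rewrite !NegzE; lia.
have -> : lucas P Q (Negz m.+2) =
  - (P * lucas_nat P Q m.+2 - Q * lucas_nat P Q m.+1) / Q ^+ m.+3 by [].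
have -> : lucas P Q (Negz m.+1) = - lucas_nat P Q m.+2 / Q ^+ m.+2 by [].
have -> : lucas P Q (Negz m) = - lucas_nat P Q m.+1 / Q ^+ m.+1 by [].
move: (lucas_nat P Q m.+2) (lucas_nat P Q m.+1) => x y.
rewrite !(exprS Q _.+1).
have: Q ^+ m.+1 != 0 by rewrite expf_neq0.
move: (Q ^+ m.+1) => q q0.
by field; rewrite q0 Q0.
Qed.

Lemma is_lucas_eq (F : fieldType) (P Q : F) (D : int -> F) :
  Q != 0 -> is_lucas P Q D -> D =1 lucas P Q.
Proof.
move=> Q0 [D0 D1 DS]; have [L0 L1 LS] := lucasP P Q0.
have pos (m : nat) :
    D m = lucas P Q m /\ D (m%:Z + 1) = lucas P Q (m%:Z + 1).
  elim: m => [|m [IH1 IH2]]; first by rewrite add0r D0 D1.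
  rewrite -(addn1 m) PoszD; split=> //.
  by rewrite -addrA DS LS IH1 IH2.
have neg (m : nat) :
    D (- m%:Z) = lucas P Q (- m%:Z) /\ D (- m%:Z + 1) = lucas P Q (- m%:Z + 1).
  elim: m => [|m [IH1 IH2]]; first by rewrite oppr0 add0r D0 D1.
  have e1 : - m.+1%:Z + 1 = - m%:Z by lia.
  have e2 : - m.+1%:Z + 2 = - m%:Z + 1 by lia.
  split; last by rewrite e1.
  have := DS (- m.+1%:Z); have := LS (- m.+1%:Z); rewrite e1 e2 IH1 IH2 => ->.
  by move/addrI/oppr_inj/(mulfI Q0).
case=> m; first by case: (pos m).
by rewrite NegzE; case: (neg m.+1).
Qed.

(* Main.v *)
(** With [u n = D n ^ 2 / Q ^ n], Catalan's identity reads
    [D (x - y) * D (x + y) / Q ^ x = u x - u y]. Dividing the sum by [Q ^ b]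
    thus turns it into the trivial identity
    [(ub - u3)(u1 - u2) + (ub - u1)(u2 - u3) + (ub - u2)(u3 - u1) = 0]. *)

Require Import Defs.
From HB Require Import structures.
From mathcomp Require Import all_boot all_order all_algebra.
From mathcomp Require Import complex.
From mathcomp Require Import reals.
From mathcomp Require Import zify ring.

Import Order.TTheory GRing.Theory Num.Theory.

Local Open Scope ring_scope.
Local Open Scope complex_scope.

(** Two consecutive zeros propagate upwards by the recurrence and downwards because [Q] can be
    cancelled. Identities linear in a sequence thus need checking at [0] and [1] only. *)
Lemma lucas_rec_eq0 (F : fieldType) (P Q : F) (f : int -> F) :
  Q != 0 -> f 0 = 0 -> f 1 = 0 ->
  (forall n, f (n + 2) = P * f (n + 1) - Q * f n) -> forall n, f n = 0.
Proof.
move=> Q0 f0 f1 fS n.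
suff [] : f n = 0 /\ f (n + 1) = 0 by [].
elim/int_rec: n => [|n [IH1 IH2]|n [IH1 IH2]]; first by rewrite add0r.
- have -> : n.+1%:Z = n%:Z + 1 by lia.
  by split=> //; rewrite -addrA fS IH1 IH2 !mulr0 subr0.
- have e1 : - n.+1%:Z + 1 = - n%:Z by lia.
  have e2 : - n.+1%:Z + 2 = - n%:Z + 1 by lia.
  split; last by rewrite e1.
  have := fS (- n.+1%:Z); rewrite e1 e2 IH1 IH2 mulr0 sub0r.
  by move/esym/eqP; rewrite oppr_eq0 mulf_eq0 (negPf Q0) => /eqP.
Qed.

Section IsLucas.
Variables (F : fieldType) (P Q : F) (D : int -> F).
Hypotheses (Q0 : Q != 0) (hD : is_lucas P Q D).

Lemma is_lucasS (n : int) : D (n + 1) = P * D n - Q * D (n - 1).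
Proof.
have [_ _ DS] := hD; have := DS (n - 1).
by rewrite -addrA subrK.
Qed.

Lemma is_lucasN (n : int) : D (- n) = - D n / Q ^ n.
Proof. by rewrite !(is_lucas_eq Q0 hD) lucasN. Qed.

(** For fixed [x], the difference of the two sides satisfies the recurrence in [y]. *)
Lemma is_lucasD (x y : int) : D (x + y) = D x * D (y + 1) - Q * D (x - 1) * D y.
Proof.
have [D0 D1 DS] := hD.
apply/eqP; rewrite -subr_eq0; apply/eqP; move: y.
apply: (@lucas_rec_eq0 F P Q) => // [||n].
- by rewrite !(addr0, add0r) D0 D1; ring.
- have -> : D (1 + 1) = P by rewrite is_lucasS subrr D0 D1; ring.
  by rewrite is_lucasS D1; ring.
- have DS1 m : D (m + 1 + 1) = P * D (m + 1) - Q * D m by rewrite -addrA DS.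
  by rewrite !addrA !DS1; ring.
Qed.

(** This is [is_lucasD] at [- y], with [D (- y)] and [D (- (y - 1))] reflected by [is_lucasN]. *)
Lemma is_lucasB (x y : int) :
  D (x - y) = Q * (D (x - 1) * D y - D x * D (y - 1)) / Q ^ y.
Proof.
have Qy0 : Q ^ y != 0 by rewrite expfz_neq0.
rewrite is_lucasD (addrC (- y)) -(opprB y) !is_lucasN.
have -> : Q ^ (y - 1) = Q ^ y / Q by rewrite expfzDr.
by field; rewrite Q0 Qy0.
Qed.

(** Expand [D ((n + 1) - n) = 1] by [is_lucasB], then eliminate [D (n + 1)]. *)
Lemma is_lucas_cassini (n : int) :
  D n ^+ 2 - P * D n * D (n - 1) + Q * D (n - 1) ^+ 2 = Q ^ n / Q.
Proof.
have Qn0 : Q ^ n != 0 by rewrite expfz_neq0.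
have [_ D1 _] := hD.
have := is_lucasB (n + 1) n.
rewrite [n + 1 - n]addrC addKr D1 addrK is_lucasS => /(canLR (mulfVK Qn0)).
rewrite mul1r => ->.
by field.
Qed.

Lemma is_lucas_catalan (x y : int) :
  D (x - y) * D (x + y) = Q ^ x * (D x ^+ 2 / Q ^ x - D y ^+ 2 / Q ^ y).
Proof.
have Qx0 : Q ^ x != 0 by rewrite expfz_neq0.
have Qy0 : Q ^ y != 0 by rewrite expfz_neq0.
(* Exposes the right-hand side of Cassini's identity: replacing [Q ^ x] and [Q ^ y] by quadratic
   forms leaves a polynomial identity in [D x], [D (x - 1)], [D y], [D (y - 1)]. *)
have Qexp n : Q ^ n = Q * (Q ^ n / Q) by rewrite mulrC mulfVK.
have -> : Q ^ x * (D x ^+ 2 / Q ^ x - D y ^+ 2 / Q ^ y)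
          = (D x ^+ 2 * Q ^ y - Q ^ x * D y ^+ 2) / Q ^ y.
  by field; rewrite Qx0 Qy0.
rewrite is_lucasB (is_lucasD x y) (is_lucasS y) mulrAC; congr (_ / _).
by rewrite (Qexp x) (Qexp y) -!is_lucas_cassini; ring.
Qed.

End IsLucas.

Theorem lemma3p3 (R : realType) (P Q : R[i]) (hQ : Q != 0)
    (D : int -> R[i]) (hD : is_lucas P Q D) (a1 a2 a3 b : int) :
  (D (b - a3) * D (b + a3) * D (a1 - a2) * D (a1 + a2)) / Q ^ a1
  + (D (b - a1) * D (b + a1) * D (a2 - a3) * D (a2 + a3)) / Q ^ a2
  + (D (b - a2) * D (b + a2) * D (a3 - a1) * D (a3 + a1)) / Q ^ a3
  = 0.
Proof.
have Qn0 n : Q ^ n != 0 by rewrite expfz_neq0.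
have cancel n (v : R[i]) : Q ^ n * v / Q ^ n = v by rewrite mulrAC mulfV ?mul1r.
(* In each term the second pair of factors yields the power of [Q] that cancels the denominator; the
   first pair yields the common factor [Q ^ b]. *)
rewrite -!(mulrA (D (b - _) * _)) !(is_lucas_catalan _ _ _ _ hQ hD).
by rewrite !cancel; ring.
Qed.
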